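(* Let $n\ge 3$, and let $S_n$ be the symmetric group on $n$ elements equipped with the Hamming distance $d_H(\pi,\pi')=|\{i:\pi(i)\ne\pi'(i)\}|$. Let $J_n=K_n\,\square\,K_{n-1}\,\square\cdots\square\,K_2$. Then $$\sigma_{S_n}^2>\frac n4>\sigma_{J_n}^2+\frac14.$$
   Context: For a finite metric space $(\Omega,d)$ with the uniform probability distribution, a function $X:\Omega\to\mathbb{R}$ is Lipschitz if $|X(u)-X(v)|\le d(u,v)$ for all $u,v$, and $\sigma_X^2$ is the smallest $\sigma^2$ such that $\mathbb{E}\,e^{t(X-\mathbb{E}X)}\le e^{\sigma^2t^2/2}$ for all real $t$. The subgaussian constant $\sigma_\Omega^2$ is the supremum of $\sigma_X^2$ over all Lipschitz $X$ on $\Omega$. For a graph, $\Omega$ is the vertex set with the graph distance. $K_m$ is the complete graph on $m$ vertices, and $\square$ denotes the Cartesian product of graphs (vertex set the product of the vertex sets, distance the sum of the coordinate distances). *)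

(* Defs.v *)
From mathcomp Require Import all_boot all_order all_algebra all_fingroup.
From mathcomp Require Import all_classical all_reals all_analysis.

Set Implicit Arguments.
Unset Strict Implicit.
Unset Printing Implicit Defensive.

Import Order.TTheory GRing.Theory Num.Theory.

Local Open Scope ring_scope.

Section Subgaussian.
Variables (R : realType) (T : finType).
Implicit Types (d : T -> T -> R) (X : T -> R).

Definition unif_mean X : R := (\sum_(u : T) X u) / #|T|%:R.

Definition lipschitz d X : Prop := forall u v : T, `|X u - X v| <= d u v.

Definition subgaussian_bound X (s : R) : Prop :=
  forall t : R,
    unif_mean (fun u => expR (t * (X u - unif_mean X))) <= expR (s * t ^+ 2 / 2).

(* sigma_X^2 and sigma_Omega^2 live in \bar R, so that neither the infimum nor
   the supremum can take a default value. *)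
Definition sigma2 X : \bar R :=
  ereal_inf [set s%:E | s in [set s : R | subgaussian_bound X s]]%classic.

Definition subgaussian_constant d : \bar R :=
  ereal_sup [set sigma2 X | X in [set X : T -> R | lipschitz d X]]%classic.

(* The infimum in sigma2 is a minimum. *)
Lemma sigma2_attained X (s : R) : sigma2 X = s%:E -> subgaussian_bound X s.
Proof.
move=> sX t; rewrite leNgt; apply/negP => lt.
set L := unif_mean _ in lt.
have L0 : 0 < L by exact: lt_trans (expR_gt0 _) lt.
have [t0|t0] := eqVneq t 0.
  have : (sigma2 X < +oo)%E by rewrite sX ltry.
  move=> /ereal_inf_lt[_ [r /= /(_ t) + _] _]; rewrite -/L leNgt => /negP; apply.
  by move: lt; rewrite t0 expr0n /= !mulr0 !mul0r.
have t2 : 0 < t ^+ 2 by rewrite exprn_even_gt0.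
have : ((ln L * 2 / t ^+ 2)%:E <= sigma2 X)%E.
  apply: le_ereal_inf_tmp => _ [r /= /(_ t) + <-]; rewrite -/L lee_fin => Lr.
  rewrite ler_pdivrMr // -ler_pdivlMr //.
  by rewrite -ler_expR lnK // posrE.
rewrite sX lee_fin ler_pdivrMr // -ler_pdivlMr //.
by rewrite -ler_expR lnK ?posrE // leNgt lt.
Qed.

End Subgaussian.

Definition hamming (n : nat) (p q : 'S_n) : nat := #|[set i : 'I_n | p i != q i]|.

Record sgraph := SGraph {
  vertex :> finType;
  adj : rel vertex;
  adj_sym : symmetric adj;
  adj_irr : irreflexive adj }.

(* The least length of a walk from u to v. Lengths below #|G| suffice when v is
   reachable from u; otherwise the value is #|G|. *)
Definition gdist (G : sgraph) (u v : G) : nat :=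
  find (fun k => [exists p : k.-tuple G, path (@adj G) u p && (last u p == v)])
       (iota 0 #|G|).

Section Complete.
Variable m : nat.
Definition complete_adj : rel 'I_m := fun u v => u != v.
Lemma complete_adj_sym : symmetric complete_adj.
Proof. by move=> u v; rewrite /complete_adj eq_sym. Qed.
Lemma complete_adj_irr : irreflexive complete_adj.
Proof. by move=> u; rewrite /complete_adj eqxx. Qed.
Definition complete_graph : sgraph := SGraph complete_adj_sym complete_adj_irr.
End Complete.

Section CartesianProduct.
Variables G H : sgraph.
Definition cartesian_adj : rel (G * H) := fun u v =>
  (u.1 == v.1) && adj u.2 v.2 || adj u.1 v.1 && (u.2 == v.2).
Lemma cartesian_adj_sym : symmetric cartesian_adj.
Proof.
by move=> u v; rewrite /cartesian_adj !(eq_sym u.1) !(eq_sym u.2) !(adj_sym u.1)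
  !(adj_sym u.2).
Qed.
Lemma cartesian_adj_irr : irreflexive cartesian_adj.
Proof. by move=> u; rewrite /cartesian_adj !adj_irr andbF. Qed.
Definition cartesian_product : sgraph :=
  SGraph cartesian_adj_sym cartesian_adj_irr.
End CartesianProduct.

(* K_n [] K_(n-1) [] ... [] K_2 for n >= 2, associated to the right. *)
Fixpoint Jgraph (n : nat) : sgraph :=
  match n with
  | (_.+2 as p).+1 => cartesian_product (complete_graph n) (Jgraph p)
  | _ => complete_graph n
  end.

Section GraphDistance.

Lemma gdist_le (G : sgraph) (u : G) (p : seq G) :
  path (@adj G) u p -> (gdist u (last u p) <= size p)%N.
Proof.
case/shortenP=> q qP qU sub0.
have sub : (size q <= size p)%N by apply: uniq_leq_size; first by case/andP: qU.
have szq : (size q < #|G|)%N.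
  by have := max_card (mem (u :: q)); rewrite (card_uniqP qU).
apply: leq_trans sub; rewrite /gdist.
set P := (X in find X _).
have Pq : P (size q).
  by apply/existsP; exists (in_tuple q); rewrite /= qP eqxx.
rewrite leqNgt; apply/negP => lt.
have /= := before_find 0%N lt.
by rewrite nth_iota // add0n Pq.
Qed.

Lemma gdist_walk (G : sgraph) (u v : G) : connect (@adj G) u v ->
  exists p : seq G,
    [/\ path (@adj G) u p, last u p = v & size p = gdist u v].
Proof.
case/connectP=> p pP ->; case/shortenP: pP => q qP qU _.
have szq : (size q < #|G|)%N.
  by have := max_card (mem (u :: q)); rewrite (card_uniqP qU).
rewrite /gdist; set P := (X in find X _).
have hasP : has P (iota 0 #|G|).
  apply/hasP; exists (size q); first by rewrite mem_iota.
  by apply/existsP; exists (in_tuple q); rewrite /= qP eqxx.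
have /= := nth_find 0%N hasP.
have := hasP; rewrite has_find size_iota => lt.
rewrite nth_iota // add0n => /existsP[r /andP[rP /eqP rw]].
by exists r; rewrite rP rw size_tuple.
Qed.

Lemma connect_complete (m : nat) (u v : complete_graph m) :
  connect (@adj (complete_graph m)) u v.
Proof.
by case: (eqVneq u v) => [->|uv]; [exact: connect0 | exact: connect1].
Qed.

Lemma gdist_complete (m : nat) (u v : complete_graph m) :
  gdist u v = (u != v).
Proof.
case: (eqVneq u v) => [->|uv] /=.
  by apply/eqP; rewrite -leqn0; exact: (@gdist_le _ v [::]).
apply/eqP; rewrite eqn_leq; apply/andP; split.
  by apply: (@gdist_le _ u [:: v]); rewrite /= andbT.
have [[|w p] [_ /= uv' <-]] := gdist_walk (connect_complete u v) => //.
by rewrite uv' eqxx in uv.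
Qed.

Lemma cartesian_walk (G H : sgraph) (u : cartesian_product G H)
    (p : seq G) (q : seq H) :
  path (@adj G) u.1 p -> path (@adj H) u.2 q ->
  let r : seq (cartesian_product G H) :=
    [seq (x, u.2) | x <- p] ++ [seq (last u.1 p, y) | y <- q] in
  path (@adj (cartesian_product G H)) u r
    /\ last u r = (last u.1 p, last u.2 q).
Proof.
case: u => a b /=; elim: p a => [|x p IH] a /=.
  move=> _; elim: q b => [|y q IH] b //= /andP[bY qP].
  have [H1 H2] := IH y qP.
  by split; [rewrite H1 andbT /cartesian_adj /= eqxx bY | exact: H2].
move=> /andP[ax pP] qP; have [H1 H2] := IH x pP qP.
by split; [rewrite H1 andbT /cartesian_adj /= eqxx ax orbT | exact: H2].
Qed.

Lemma cartesian_walk_proj (G H : sgraph) (u : cartesian_product G H)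
    (r : seq (cartesian_product G H)) :
  path (@adj (cartesian_product G H)) u r ->
  exists p : seq G, exists q : seq H,
    [/\ path (@adj G) u.1 p, path (@adj H) u.2 q,
        last u.1 p = (last u r).1, last u.2 q = (last u r).2
      & (size p + size q)%N = size r].
Proof.
elim: r u => [|[x y] r IH] [a b] /=; first by exists [::], [::].
case/andP=> /orP[] /andP[/= h1 h2] /IH[p [q [/= pP qP lp lq sz]]].
  rewrite (eqP h1); exists p, (y :: q).
  by split; rewrite //= ?h2 // -sz addnS.
rewrite (eqP h2); exists (x :: p), q.
by split; rewrite //= ?h1 // -sz.
Qed.

Lemma connect_cartesian (G H : sgraph) (u v : cartesian_product G H) :
  connect (@adj G) u.1 v.1 -> connect (@adj H) u.2 v.2 ->
  connect (@adj (cartesian_product G H)) u v.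
Proof.
move=> /connectP[p pP lp] /connectP[q qP lq].
have [rP lr] := cartesian_walk pP qP.
by apply/connectP; eexists; [exact: rP | rewrite lr -lp -lq -surjective_pairing].
Qed.

Lemma gdist_cartesian (G H : sgraph) (u v : cartesian_product G H) :
  connect (@adj G) u.1 v.1 -> connect (@adj H) u.2 v.2 ->
  gdist u v = (gdist u.1 v.1 + gdist u.2 v.2)%N.
Proof.
move=> c1 c2; apply/eqP; rewrite eqn_leq; apply/andP; split.
  have [p [pP lp <-]] := gdist_walk c1; have [q [qP lq <-]] := gdist_walk c2.
  have [rP lr] := cartesian_walk pP qP.
  have := gdist_le rP; rewrite lr lp lq -surjective_pairing.
  by rewrite size_cat !size_map.
have [r [rP lr <-]] := gdist_walk (connect_cartesian c1 c2).
have [p [q [pP qP lp lq <-]]] := cartesian_walk_proj rP.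
by rewrite -lr -lp -lq leq_add // gdist_le.
Qed.

Lemma connect_J (n : nat) (u v : Jgraph n) : connect (@adj (Jgraph n)) u v.
Proof.
elim: n u v => [|[|[|n]] IH] u v; try exact: connect_complete.
by apply: connect_cartesian; [exact: connect_complete | exact: IH].
Qed.

Lemma gdist_J (n : nat) (u v : Jgraph n.+3) :
  gdist u v = ((u.1 != v.1) + gdist u.2 v.2)%N.
Proof.
rewrite -gdist_complete.
by apply: gdist_cartesian; [exact: connect_complete | exact: (@connect_J n.+2)].
Qed.

End GraphDistance.

(* Main.v *)
Require Import Defs.
From mathcomp Require Import all_boot all_order all_algebra all_fingroup.
From mathcomp Require Import all_classical all_reals all_analysis.
From mathcomp Require Import ring lra.
Import Order.TTheory GRing.Theory Num.Theory.
Import numFieldNormedType.Exports.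
Local Open Scope ring_scope.

(* The subgaussian constant of a function is at least its variance. On S_n take
   X(p) = 2 #|{i in A | p i in A}| with #|A| = floor(n/2), up to centering: two
   permutations have the same sum of values over all indices, so the sum over A
   moves by at most half of the Hamming distance, and the hypergeometric
   variance 4 k^2 (n-k)^2 / (n^2 (n-1)) exceeds n/4.
   On J_n, subgaussian bounds add up over the factors of the product. Each K_m
   contributes at most 1/4 by Hoeffding's lemma, and K_3 strictly less (20/81
   works): by convexity only {0,1}-valued functions matter there, and none of
   them has mean 1/2. *)

(** * Inequalities for the exponential and for two-point distributions *)

Lemma le_of_derive_ge0 (R : realType) (f df : R -> R) :
  (forall x : R, is_derive x 1 f (df x)) -> (forall x : R, 0 <= x -> 0 <= df x) ->
  forall x : R, 0 <= x -> f 0 <= f x.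
Proof.
move=> fdf df0 x; rewrite le_eqVlt => /predU1P[<- //|x0].
have [|c] := MVT x0 (fun y _ => fdf y).
  apply: continuous_subspaceT => y.
  by apply/differentiable_continuous/derivable1_diffP; have [] := fdf y.
rewrite in_itv/= => /andP[/ltW c0 _] E.
by rewrite -subr_ge0 E mulr_ge0 ?df0 // subr0 ltW.
Qed.

(* The quotient rule bounds the derivative of [N / D] by [1]. *)
Lemma le_mul_of_derive_quotient (R : realType) (N D dN dD : R -> R) :
  (forall x : R, is_derive x 1 N (dN x)) ->
  (forall x : R, is_derive x 1 D (dD x)) ->
  (forall x, 0 < D x) -> N 0 = 0 ->
  (forall x : R, 0 <= x -> dN x * D x - N x * dD x <= D x ^+ 2) ->
  forall x : R, 0 <= x -> N x <= x * D x.
Proof.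
move=> HN HD D0 N0 le x x0.
pose f : R -> R := (fun y => y : R) - N * (fun y => (D y)^-1).
have fE (y : R) : f y = y - N y / D y by [].
have fdf (y : R) : is_derive y 1 f (1 - (dN y * D y - N y * dD y) / D y ^+ 2).
  have Dy : D y != 0 by rewrite gt_eqF.
  have HV := is_deriveV Dy (HD y).
  apply: is_derive_eq; rewrite /GRing.scale /=; field; exact: Dy.
have df0 y : 0 <= y -> 0 <= 1 - (dN y * D y - N y * dD y) / D y ^+ 2.
  by move=> y0; rewrite subr_ge0 ler_pdivrMr ?exprn_gt0 // mul1r le.
have := le_of_derive_ge0 _ _ _ fdf df0 x x0.
by rewrite !fE N0 mul0r subr0 subr_ge0 ler_pdivrMr.
Qed.

(** In the quotient rule, [D x ^+ 2] exceeds [dN x * D x - N x * dD x] by the perfect square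
    [(1 - p - p * expR x) ^+ 2]. *)
Lemma expR_ratio_le (R : realType) (p : R) (t : R) :
  0 <= p <= 1 -> 0 <= t ->
  4 * p * (1 - p) * (expR t - 1) <= t * (1 - p + p * expR t).
Proof.
move=> /andP[p0 p1].
pose N (x : R) := 4 * p * (1 - p) * (expR x - 1).
pose D (x : R) := 1 - p + p * expR x.
apply: (@le_mul_of_derive_quotient _ N D (fun x => 4 * p * (1 - p) * expR x)
  (fun x => p * expR x)) => [x|x|x||x x0].
- apply: is_derive_eq; rewrite /GRing.scale /=; ring.
- apply: is_derive_eq; rewrite /GRing.scale /=; ring.
- have := expR_gt0 x; rewrite /D => e0.
  move: p0; rewrite le_eqVlt => /predU1P[<-|p0]; first by rewrite mul0r; lra.
  by rewrite ltr_wpDl ?mulr_gt0 //; lra.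
- by rewrite /N expR0 subrr mulr0.
- rewrite -subr_ge0 /N /D.
  have -> : forall y : R, (1 - p + p * y) ^+ 2 - (4 * p * (1 - p) * y *
    (1 - p + p * y) - 4 * p * (1 - p) * (y - 1) * (p * y)) = (1 - p - p * y) ^+ 2.
    by move=> y; ring.
  exact: sqr_ge0.
Qed.

(** With y = [expR t], this bounds ln y from below by its Pade approximant of type (2,2) at 1; the
    defect in the quotient rule is (y - 1)^4. *)
Lemma expR_pade_le (R : realType) (t : R) : 0 <= t ->
  3 * (expR t ^+ 2 - 1) <= t * (expR t ^+ 2 + 4 * expR t + 1).
Proof.
pose N (x : R) := 3 * (expR x ^+ 2 - 1).
pose D (x : R) := expR x ^+ 2 + 4 * expR x + 1.
apply: (@le_mul_of_derive_quotient _ N D (fun x => 6 * expR x ^+ 2)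
  (fun x => 2 * expR x ^+ 2 + 4 * expR x)) => [x|x|x||x x0].
- apply: is_derive_eq; rewrite /GRing.scale /=; ring.
- apply: is_derive_eq; rewrite /GRing.scale /=; ring.
- have := expR_gt0 x; rewrite /D => e0.
  by rewrite !addr_gt0 ?mulr_gt0 ?exprn_gt0.
- by rewrite /N expR0 expr1n subrr mulr0.
- rewrite -subr_ge0 /N /D.
  have -> : forall y : R, (y ^+ 2 + 4 * y + 1) ^+ 2 - (6 * y ^+ 2 *
    (y ^+ 2 + 4 * y + 1) - 3 * (y ^+ 2 - 1) * (2 * y ^+ 2 + 4 * y))
    = ((y - 1) ^+ 2) ^+ 2.
    by move=> y; ring.
  exact: sqr_ge0.
Qed.

(** The quotient of the left side by the right side is 1 at 0, and the hypothesis says exactly that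
    its derivative is nonpositive. *)
Lemma two_point_mgf_nneg (R : realType) (p c : R) :
  (forall t, 0 <= t -> p * (1 - p) * (expR t - 1) <= c * t * (1 - p + p * expR t)) ->
  forall t, 0 <= t -> 1 - p + p * expR t <= expR (p * t + c * t ^+ 2 / 2).
Proof.
move=> le t t0.
pose g (x : R) := expR (- (p * x + c * x ^+ 2 / 2)).
pose f (x : R) := - (g x * (1 - p + p * expR x)).
pose df (x : R) := g x *
  (c * x * (1 - p + p * expR x) - p * (1 - p) * (expR x - 1)).
have gdg (x : R) : is_derive x 1 g (- (p + c * x) * g x).
  have h : is_derive x 1 (fun x : R => - (p * x + c * x ^+ 2 / 2)) (- (p + c * x)).
    by apply: is_derive_eq; rewrite /GRing.scale /=; field.
  apply: is_derive_eq; rewrite -/(g x); ring.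
have fdf (x : R) : is_derive x 1 f (df x).
  by apply: is_derive_eq; rewrite /df /GRing.scale /=; ring.
have df0 x : 0 <= x -> 0 <= df x.
  by move=> x0; rewrite mulr_ge0 ?expR_ge0 // subr_ge0 le.
have := le_of_derive_ge0 _ _ _ fdf df0 t t0.
rewrite /f /g lerN2 expR0 expr0n /= !mulr0 mul0r addr0 oppr0 expR0 mulr1 subrK mul1r.
by rewrite expRN mulrC ler_pdivrMr ?expR_gt0 // mul1r.
Qed.

(** Exchanging the two points replaces [p] by [1 - p] and [t] by [- t], so the second hypothesis
    settles negative [t]. *)
Lemma two_point_mgf (R : realType) (p c : R) :
  (forall t, 0 <= t -> p * (1 - p) * (expR t - 1) <= c * t * (1 - p + p * expR t)) ->
  (forall t, 0 <= t -> p * (1 - p) * (expR t - 1) <= c * t * (p + (1 - p) * expR t)) ->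
  forall t, 1 - p + p * expR t <= expR (p * t + c * t ^+ 2 / 2).
Proof.
move=> le1 le2 t; have [t0|/ltW t0] := leP 0 t; first exact: two_point_mgf_nneg.
have le3 s : 0 <= s ->
    (1 - p) * (1 - (1 - p)) * (expR s - 1)
    <= c * s * (1 - (1 - p) + (1 - p) * expR s).
  by move=> /le2; rewrite (_ : 1 - (1 - p) = p) ?(mulrC (1 - p) p) //; ring.
have := two_point_mgf_nneg _ _ _ le3 (- t); rewrite oppr_ge0 => /(_ t0).
rewrite (_ : _ * - t + _ = p * t + c * t ^+ 2 / 2 - t); last by ring.
rewrite expRB ler_pdivlMr ?expR_gt0 // mulrDl -(mulrA (1 - p)) -expRD addNr expR0 mulr1.
by rewrite (_ : _ + (1 - p) = 1 - p + p * expR t) //; ring.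
Qed.

Lemma expR_chord (R : realType) (a b x : R) : 0 <= x <= 1 ->
  expR (a * x + b) <= (1 - x) * expR b + x * expR (a + b).
Proof.
rewrite -[x <= 1]subr_ge0 => /andP[x0 x1].
(* Weighting the tangent at [a * x + b], taken at both endpoints, by [1 - x] and [x] cancels the
   linear terms. *)
have tangent u : expR (a * x + b) * (1 + (u - (a * x + b))) <= expR u.
  have -> : expR u = expR (a * x + b) * expR (u - (a * x + b)).
    by rewrite -expRD addrC subrK.
  by rewrite ler_wpM2l ?expR_ge0 ?expR_ge1Dx.
have := lerD (ler_wpM2l x1 (tangent b)) (ler_wpM2l x0 (tangent (a + b))).
by apply: le_trans; rewrite le_eqVlt; apply/predU1P; left; ring.
Qed.

(** * Uniform means and Hoeffding's lemma *)

Section Mean.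
Variables (R : realType) (T : finType).
Implicit Types f g : T -> R.

Lemma unif_mean_le f g : (forall u, f u <= g u) -> unif_mean f <= unif_mean g.
Proof. by move=> fg; rewrite ler_wpM2r ?invr_ge0 ?ler0n //; apply: ler_sum. Qed.

Lemma unif_mean_eq f g : f =1 g -> unif_mean f = unif_mean g.
Proof. by move=> fg; rewrite /unif_mean (eq_bigr _ (fun u _ => fg u)). Qed.

Lemma unif_meanD f g : unif_mean (fun u => f u + g u) = unif_mean f + unif_mean g.
Proof. by rewrite /unif_mean big_split mulrDl. Qed.

Lemma unif_meanZ k f : unif_mean (fun u => k * f u) = k * unif_mean f.
Proof. by rewrite /unif_mean -mulr_sumr mulrA. Qed.

Lemma unif_mean_cst (k : R) : (0 < #|T|)%N -> unif_mean (fun _ : T => k) = k.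
Proof.
move=> T0; rewrite /unif_mean sumr_const -[X in X / _]mulr_natr mulfK //.
by rewrite pnatr_eq0 -lt0n.
Qed.

End Mean.

(** On an empty type the mean is a division by zero, hence 0. *)
Lemma subgaussian_bound_card0 (R : realType) (T : finType) (X : T -> R) (s : R) :
  #|T| = 0%N -> subgaussian_bound X s.
Proof.
by move=> T0 t; rewrite {1}/unif_mean T0 invr0 mulr0 expR_ge0.
Qed.

Lemma unif_mean01 (R : realType) (T : finType) (Y : T -> R) :
  (forall u, 0 <= Y u <= 1) -> 0 <= unif_mean Y <= 1.
Proof.
move=> Y01; have [T0|T0] := posnP #|T|.
  by rewrite /unif_mean T0 invr0 mulr0 lexx ler01.
rewrite -[X in X <= _ <= _](unif_mean_cst R T 0 T0).
rewrite -[X in _ <= _ <= X](unif_mean_cst R T 1 T0).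
by rewrite !unif_mean_le // => u; have /andP[] := Y01 u.
Qed.

(** Subtracting the minimum brings the values into [0,1] and leaves the centred function
    unchanged. *)
Lemma subgaussian_bound01 (R : realType) (T : finType) (s : R) :
  (forall Y : T -> R, (forall u, 0 <= Y u <= 1) -> subgaussian_bound Y s) ->
  forall X : T -> R, (forall u v, `|X u - X v| <= 1) -> subgaussian_bound X s.
Proof.
move=> H X X1; have [T0|T0] := posnP #|T|; first exact: subgaussian_bound_card0.
have [u0 _] := card_gt0P T0.
case: (arg_minP X (erefl : predT u0)) => m _ mX.
have Y01 u : 0 <= X u - X m <= 1.
  by rewrite subr_ge0 mX // (le_trans (ler_norm _)).
move=> t; apply: le_trans (H _ Y01 t); rewrite unif_meanD unif_mean_cst //.
by apply: unif_mean_le => u; rewrite (_ : X u - X m - _ = X u - unif_mean X) //; ring.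
Qed.

(** The chord of the exponential compares [X] with the {0,1}-valued variable of the same mean [p],
    for which [expR_ratio_le] gives the constant 1/4. *)
Lemma hoeffding (R : realType) (T : finType) (X : T -> R) :
  (forall u v, `|X u - X v| <= 1) -> subgaussian_bound X (1 / 4).
Proof.
move: X; apply: subgaussian_bound01 => X X01 t.
have [T0|T0] := posnP #|T|; first exact: subgaussian_bound_card0.
set p := unif_mean X; have p01 : 0 <= p <= 1 by exact: unif_mean01.
have le1 (r : R) : 0 <= r <= 1 -> forall s, 0 <= s ->
    r * (1 - r) * (expR s - 1) <= 1 / 4 * s * (1 - r + r * expR s).
  by move=> r01 s s0; have := expR_ratio_le R r s r01 s0; lra.
have le2 s : 0 <= s ->
    p * (1 - p) * (expR s - 1) <= 1 / 4 * s * (p + (1 - p) * expR s).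
  move=> s0; have := le1 (1 - p) _ s s0.
  by rewrite subr_ge0 lerBlDr lerDl andbC p01 => /(_ isT); lra.
have := two_point_mgf R p _ (le1 p p01) le2 t.
rewrite -(ler_pM2r (expR_gt0 (- (t * p)))) -expRD.
rewrite (_ : _ - t * p = 1 / 4 * t ^+ 2 / 2); last by ring.
apply: le_trans.
have -> : (1 - p + p * expR t) * expR (- (t * p)) =
    unif_mean (fun u => expR (- (t * p)) + expR (- (t * p)) * (expR t - 1) * X u).
  by rewrite unif_meanD unif_meanZ unif_mean_cst // -/p; ring.
apply: unif_mean_le => u.
have := expR_chord R t 0 (X u) (X01 u).
rewrite expR0 !addr0 -(ler_pM2r (expR_gt0 (- (t * p)))) -expRD.
by rewrite (_ : t * X u + _ = t * (X u - p)); lra.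
Qed.

(** * The sharper bound on three points *)

(** Three times the centred moment generating function on three points, with the values as separate
    arguments so that each can vary alone. *)
Definition three_point_sum (R : realType) (t a b c : R) : R :=
  let m := (a + b + c) / 3 in
  expR (t * (a - m)) + expR (t * (b - m)) + expR (t * (c - m)).

Section ThreePoints.
Variables (R : realType) (t : R).
Local Notation G := (three_point_sum R t).

Let G_rot a b c : G a b c = G b c a.
Proof. by rewrite /three_point_sum (_ : a + b + c = b + c + a); ring. Qed.

Let G_shift a b c k : G (a + k) (b + k) (c + k) = G a b c.
Proof.
rewrite /three_point_sum; set m := _ / 3; set m' := _ / 3.
have -> : m = m' + k by rewrite /m /m'; field.
by rewrite !opprD !(addrACA _ k) subrr !addr0.
Qed.

(* [G] is convex in each variable. *)
Let G_endpoints (K a b c : R) : 0 <= a <= 1 -> G 0 b c <= K -> G 1 b c <= K ->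
  G a b c <= K.
Proof.
move=> a01; rewrite /three_point_sum.
(* [k] is 1 for the term of the moving value [a] and 0 for the other two; either way the exponent is
   affine in [a]. *)
have H k u : expR (t * (k * a + u - (a + b + c) / 3)) <=
   (1 - a) * expR (t * (u - (0 + b + c) / 3))
   + a * expR (t * (k + u - (1 + b + c) / 3)).
  have := expR_chord R (t * (k - 1 / 3)) (t * (u - (0 + b + c) / 3)) a a01.
  rewrite (_ : t * (k - 1 / 3) * a + t * (u - (0 + b + c) / 3) =
    t * (k * a + u - (a + b + c) / 3)); last by field.
  rewrite (_ : t * (k - 1 / 3) + t * (u - (0 + b + c) / 3) =
    t * (k + u - (1 + b + c) / 3)) //; by field.
have := lerD (lerD (H 1 0) (H 0 b)) (H 0 c).
rewrite !mul1r !mul0r !addr0 !(add0r b) !(add0r c).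
case/andP: a01; rewrite -[a <= 1]subr_ge0 => a0 a1 h h0 h1.
apply: le_trans h _.
have := lerD (ler_wpM2l a1 h0) (ler_wpM2l a0 h1).
rewrite -mulrDl subrK mul1r; apply: le_trans.
by rewrite le_eqVlt; apply/predU1P; left; ring.
Qed.

Lemma three_point_mgf (c : R) :
  (forall t, 1 - 1 / 3 + 1 / 3 * expR t <= expR (1 / 3 * t + c * t ^+ 2 / 2)) ->
  forall x y z, 0 <= x <= 1 -> 0 <= y <= 1 -> 0 <= z <= 1 -> 0 <= c ->
  G x y z <= 3 * expR (c * t ^+ 2 / 2).
Proof.
move=> Hc x y z x01 y01 z01 c0.
have E0 : G 0 0 0 <= 3 * expR (c * t ^+ 2 / 2).
  rewrite /three_point_sum !(addr0, mul0r, subr0, mulr0) expR0.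
  have : 1 <= expR (c * t ^+ 2 / 2).
    by rewrite -[X in X <= _]expR0 ler_expR divr_ge0 // mulr_ge0 ?sqr_ge0.
  by lra.
have E1 : G 0 0 1 <= 3 * expR (c * t ^+ 2 / 2).
  have -> : G 0 0 1 = 3 * (expR (- (1 / 3 * t)) * (1 - 1 / 3 + 1 / 3 * expR t)).
    rewrite /three_point_sum (_ : t * (0 - _) = - (1 / 3 * t)); last by field.
    rewrite (_ : t * (1 - _) = - (1 / 3 * t) + t); last by field.
    by rewrite expRD; field.
  rewrite ler_pM2l // expRN mulrC ler_pdivrMr ?expR_gt0 // -expRD [X in _ <= expR X]addrC.
  exact: Hc.
(* Two ones and a zero are the reflection of the previous case: apply [Hc] at [- t]. *)
have E2 : G 0 1 1 <= 3 * expR (c * t ^+ 2 / 2).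
  have -> : G 0 1 1 = 3 * (expR (1 / 3 * t) * (1 - 1 / 3 + 1 / 3 * expR (- t))).
    rewrite /three_point_sum (_ : t * (1 - _) = 1 / 3 * t); last by field.
    rewrite (_ : t * (0 - _) = 1 / 3 * t - t); last by field.
    by rewrite expRD; field.
  rewrite ler_pM2l // mulrC -ler_pdivlMr ?expR_gt0 // -expRB.
  rewrite [X in _ <= expR X]addrC -(mulrN (1 / 3)) -[t ^+ 2]sqrrN; exact: Hc.
have E3 : G 1 1 1 <= 3 * expR (c * t ^+ 2 / 2) by rewrite -(G_shift 0 0 0 1) !add0r in E0.
have E100 : G 1 0 0 <= 3 * expR (c * t ^+ 2 / 2) by rewrite G_rot.
have E010 : G 0 1 0 <= 3 * expR (c * t ^+ 2 / 2) by rewrite G_rot.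
have E101 : G 1 0 1 <= 3 * expR (c * t ^+ 2 / 2) by rewrite G_rot.
have E110 : G 1 1 0 <= 3 * expR (c * t ^+ 2 / 2) by rewrite G_rot.
(* Rotations bring each variable in turn to the first place, which leaves the eight vertices of the
   cube. *)
apply: G_endpoints x01 _ _; rewrite G_rot; apply: G_endpoints y01 _ _;
  by rewrite G_rot; apply: G_endpoints z01 _ _.
Qed.

End ThreePoints.

(* [27 / 10] exceeds [8 / 3], the constant which corresponds to Hoeffding's bound. *)
Lemma expR_third_le (R : realType) (t : R) : 0 <= t ->
  27 * (expR t - 1) <= 10 * t * (expR t + 2).
Proof.
move=> t0; have := expR_pade_le R t t0.
have : 0 <= expR t - 1 by rewrite subr_ge0 -[1]expR0 ler_expR.
move: (expR t) => y y0 pade.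
have D0 : 0 < y ^+ 2 + 4 * y + 1 by nra.
rewrite -(ler_pM2r D0).
have y2 : 0 <= 10 * (y + 2) by lra.
have := ler_wpM2l y2 pade.
(* Three times this product is [10 * (y + 2) * 3 * (y ^+ 2 - 1)] minus
   [27 * (y - 1) * (y ^+ 2 + 4 * y + 1)]. *)
have : 0 <= (y - 1) * ((y - 3) ^+ 2 + 2).
  by rewrite mulr_ge0 // addr_ge0 ?sqr_ge0.
by nra.
Qed.

Lemma three_point_subgaussian (R : realType) (X : 'I_3 -> R) :
  (forall u v, `|X u - X v| <= 1) -> subgaussian_bound X (20 / 81).
Proof.
move: X; apply: subgaussian_bound01 => X X01 t.
have c0 : 0 <= 20 / 81 :> R by lra.
(* For p = 1/3 and c = 20/81 the first condition of [two_point_mgf] is a rescaling of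
   [expR_third_le]. *)
have mgf : forall s : R,
    1 - 1 / 3 + 1 / 3 * expR s <= expR (1 / 3 * s + 20 / 81 * s ^+ 2 / 2).
  apply: two_point_mgf => s s0; have := expR_third_le R s s0; first lra.
  (* The second condition has [2 * expR s + 1] in place of [expR s + 2], which is larger by
     [expR s - 1]. *)
  have : 0 <= s * (expR s - 1).
    by rewrite mulr_ge0 // subr_ge0 -[1]expR0 ler_expR.
  by lra.
have := three_point_mgf R t _ mgf _ _ _ (X01 ord0) (X01 (lift ord0 ord0))
  (X01 (lift ord0 (lift ord0 ord0))) c0.
rewrite mulrC -ler_pdivrMr //; apply: le_trans.
by rewrite /three_point_sum /unif_mean !big_ord_recl !big_ord0 card_ord !addr0 !addrA.
Qed.

(** * Products and the upper bound for [Jgraph] *)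

Lemma unif_mean_prod (R : realType) (T U : finType) (X : T * U -> R) :
  unif_mean X = unif_mean (fun a => unif_mean (fun b => X (a, b))).
Proof.
rewrite /unif_mean -mulr_suml (pair_bigA _ (fun a b => X (a, b))) /=.
rewrite card_prod natrM invfM mulrA mulrAC.
by congr (_ / _ / _); apply: eq_bigr => -[].
Qed.

(* Conditionally on the first coordinate, [X] fluctuates around a function
   which is Lipschitz in that coordinate. *)
Lemma subgaussian_bound_prod (R : realType) (T U : finType) (dT : T -> T -> R)
    (dU : U -> U -> R) (d : T * U -> T * U -> R) (s r : R) :
  (forall u v, d u v = dT u.1 v.1 + dU u.2 v.2) ->
  (forall a, dT a a = 0) -> (forall b, dU b b = 0) ->
  (forall X : T -> R, Defs.lipschitz dT X -> subgaussian_bound X s) ->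
  (forall X : U -> R, Defs.lipschitz dU X -> subgaussian_bound X r) ->
  forall X : T * U -> R, Defs.lipschitz d X -> subgaussian_bound X (s + r).
Proof.
move=> dE dT0 dU0 HT HU X lipX t.
have [U0|U0] := posnP #|U|.
  by apply: subgaussian_bound_card0; rewrite card_prod U0 muln0.
pose Y a := unif_mean (fun b => X (a, b)).
have lipY : Defs.lipschitz dT Y.
  move=> a a'; have H b : X (a, b) <= X (a', b) + dT a a'.
    by have := lipX (a, b) (a', b); rewrite dE dU0 addr0 ler_norml /=; lra.
  have H' b : X (a', b) <= X (a, b) + dT a a'.
    by have := lipX (a, b) (a', b); rewrite dE dU0 addr0 ler_norml /=; lra.
  have := unif_mean_le _ _ _ _ H; have := unif_mean_le _ _ _ _ H'.
  by rewrite !unif_meanD !unif_mean_cst // ler_norml -/(Y a) -/(Y a'); lra.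
have lipa a : Defs.lipschitz dU (fun b => X (a, b)).
  by move=> b b'; have := lipX (a, b) (a, b'); rewrite dE dT0 add0r.
rewrite unif_mean_prod [unif_mean X]unif_mean_prod -/Y.
rewrite (_ : _ / 2 = s * t ^+ 2 / 2 + r * t ^+ 2 / 2); last by ring.
rewrite expRD.
(* The exponent splits as [t * (Y a - unif_mean Y)] plus [t * (X (a, b) - Y a)]; [HU] bounds the
   mean of the second factor over [b], uniformly in [a]. *)
apply: (@le_trans _ _ (unif_mean (fun a => expR (r * t ^+ 2 / 2) *
   expR (t * (Y a - unif_mean Y))))); last first.
  by rewrite unif_meanZ mulrC ler_wpM2r ?expR_ge0 // HT.
apply: unif_mean_le => a.
rewrite (unif_mean_eq _ _ _ (fun b => expR (t * (Y a - unif_mean Y)) *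
  expR (t * (X (a, b) - Y a)))).
  by rewrite unif_meanZ mulrC ler_wpM2r ?expR_ge0 // (HU _ (lipa a)).
by move=> b; rewrite -expRD; congr expR; ring.
Qed.

Lemma gdist_refl (G : sgraph) (u : G) : gdist u u = 0%N.
Proof. by apply/eqP; rewrite -leqn0; exact: (@gdist_le _ u [::]). Qed.

(** Of the [n.+2] complete factors, K_3 costs 20/81 and each of the others 1/4. The induction starts
    at the product of K_3 and K_2. *)
Lemma subgaussian_bound_J (R : realType) (n : nat)
    (X : Jgraph n.+3 -> R) :
  Defs.lipschitz (fun u v => (gdist u v)%:R) X ->
  subgaussian_bound X (20 / 81 + n.+1%:R / 4).
Proof.
have prod m s r : (forall X : 'I_m.+3 -> R, (forall u v, `|X u - X v| <= 1) ->
    subgaussian_bound X s) ->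
    (forall X : Jgraph m.+2 -> R, Defs.lipschitz (fun u v => (gdist u v)%:R) X ->
      subgaussian_bound X r) ->
    forall X : Jgraph m.+3 -> R, Defs.lipschitz (fun u v => (gdist u v)%:R) X ->
      subgaussian_bound X (s + r).
  move=> Hs Hr; apply: (@subgaussian_bound_prod R 'I_m.+3 (Jgraph m.+2)
    (fun u v => (u != v)%:R) (fun u v => (gdist u v)%:R)) => //.
  - by move=> u v; rewrite (@gdist_J m) natrD.
  - by move=> a; rewrite eqxx.
  - by move=> b; rewrite gdist_refl.
  - move=> Y lipY; apply: Hs => u v; apply: le_trans (lipY u v) _.
    by rewrite lern1 leq_b1.
elim: n X => [|n IH] X lipX.
  apply: prod lipX; first exact: three_point_subgaussian.
  move=> Y lipY; apply: hoeffding => u v; apply: le_trans (lipY u v) _.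
  by rewrite (@gdist_complete 2) lern1 leq_b1.
rewrite (_ : _ + _ = 1 / 4 + (20 / 81 + n.+1%:R / 4)); last first.
  by rewrite -(natr1 n.+1); field.
by apply: prod lipX => // Y; apply: hoeffding.
Qed.

Lemma subgaussian_constant_le (R : realType) (T : finType) (d : T -> T -> R)
    (s : R) :
  (forall X : T -> R, Defs.lipschitz d X -> subgaussian_bound X s) ->
  (subgaussian_constant d <= s%:E)%E.
Proof.
move=> H; apply: ge_ereal_sup => _ [X /= lipX <-].
by apply: ereal_inf_lbound; exists s => //; exact: H.
Qed.

Lemma subgaussian_constant_J (R : realType) (n : nat) : (3 <= n)%N ->
  (subgaussian_constant (fun u v : Jgraph n => (gdist u v)%:R : R) + (1 / 4)%:E
     < (n%:R / 4)%:E)%E.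
Proof.
case: n => [|[|[|n]]] // _.
have := subgaussian_constant_le _ _ _ _ (@subgaussian_bound_J R n).
move=> /(leeD2r (1 / 4)%:E) /le_lt_trans; apply.
(* What remains is 20/81 < 1/4. *)
by rewrite -EFinD lte_fin -(natr1 n.+2) -(natr1 n.+1); lra.
Qed.

(** * The variance as a lower bound *)

Lemma expRDN_ge (R : realType) (x : R) : 2 + x ^+ 2 <= expR x + expR (- x).
Proof.
wlog x0 : x / 0 <= x => [H|].
  have [|/ltW] := leP 0 x; first exact: H.
  by rewrite -oppr_ge0 => /H; rewrite sqrrN opprK addrC [_ + expR x]addrC.
(* [g] is the derivative of [f], and the derivative of [g] is nonnegative by adding the tangent
   bounds at [z] and [- z]. *)
pose g (y : R) := expR y - expR (- y) - 2 * y.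
pose f (y : R) := expR y + expR (- y) - y ^+ 2.
have dg (y : R) : is_derive y 1 g (expR y + expR (- y) - 2).
  by apply: is_derive_eq; rewrite /GRing.scale /=; ring.
have df (y : R) : is_derive y 1 f (g y).
  by apply: is_derive_eq; rewrite /g /GRing.scale /=; ring.
have g0 (y : R) : 0 <= y -> 0 <= g y.
  move=> /(le_of_derive_ge0 _ _ _ dg); rewrite /g oppr0 subrr mulr0 subr0; apply.
  by move=> z _; have := expR_ge1Dx z; have := expR_ge1Dx (- z); lra.
have := le_of_derive_ge0 _ _ _ df g0 x x0.
by rewrite /f oppr0 expR0 expr0n /= subr0 lerBrDr; lra.
Qed.

(** Adding the bounds at [t] and [- t] isolates the second-order term; an explicit small [t]
    replaces the limit at 0. *)
Lemma variance_le_subgaussian (R : realType) (T : finType) (X : T -> R) (s : R) :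
  (0 < #|T|)%N -> subgaussian_bound X s ->
  unif_mean (fun u => (X u - unif_mean X) ^+ 2) <= s.
Proof.
move=> T0 sub; set V := unif_mean _.
have V0 : 0 <= V.
  by rewrite -[X in X <= _](unif_mean_cst R T 0 T0) unif_mean_le // => u;
    rewrite sqr_ge0.
have key w : 0 < w -> V - s <= w * (V * s).
  move=> w0; set t := Num.sqrt (2 * w).
  have tw : t ^+ 2 = 2 * w by rewrite sqr_sqrtr // mulr_ge0 // ltW.
  have H : 1 + w * V <= expR (s * w).
    have := lerD (sub t) (sub (- t)); rewrite sqrrN tw -unif_meanD.
    rewrite (_ : s * (2 * w) / 2 = s * w); last by field.
    set M := unif_mean _ => HM.
    have : 2 + 2 * w * V <= M.
      rewrite -tw -(unif_mean_cst R T 2 T0) -unif_meanZ -unif_meanD.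
      by apply: unif_mean_le => u; rewrite mulNr -exprMn expRDN_ge.
    lra.
  have : (1 + w * V) * (1 - s * w) <= 1.
    have e1 := expR_ge1Dx (- (s * w)).
    have p0 : 0 <= 1 + w * V by rewrite addr_ge0 // mulr_ge0 // ltW.
    apply: le_trans (ler_wpM2l p0 e1) _.
    by rewrite expRN ler_pdivrMr ?expR_gt0 // mul1r.
  by move=> h; rewrite -(ler_pM2l w0); lra.
rewrite leNgt; apply/negP => sV.
have [s0|s0] := leP s 0.
  have := key 1 ltr01; have : V * s <= 0 by rewrite mulr_ge0_le0.
  lra.
have Vs : 0 < V * s by rewrite mulr_gt0 // (lt_trans s0).
(* This [w] makes [w * (V * s)] equal to half of [V - s], which contradicts [key]. *)
have w0 : 0 < (V - s) / (2 * (V * s)).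
  by rewrite divr_gt0 ?subr_gt0 // mulr_gt0.
have := key _ w0; rewrite (_ : (V - s) / _ * _ = (V - s) / 2); first by lra.
by field; rewrite !gt_eqF // (lt_trans s0).
Qed.

Lemma variance_le_subgaussian_constant (R : realType) (T : finType)
    (d : T -> T -> R) (X : T -> R) :
  (0 < #|T|)%N -> Defs.lipschitz d X ->
  ((unif_mean (fun u => (X u - unif_mean X) ^+ 2))%:E <= subgaussian_constant d)%E.
Proof.
move=> T0 lipX; apply: (@le_trans _ _ (sigma2 X)).
  apply: le_ereal_inf_tmp => _ [s /= sub <-].
  by rewrite lee_fin variance_le_subgaussian.
by apply: ereal_sup_ubound; exists X.
Qed.

(** * Moments of random permutations and the lower bound for the symmetric group *)

Section Permutations.
Variables (R : realType) (n : nat).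
Implicit Types (c : 'I_n -> R) (A : {set 'I_n}).

Lemma unif_mean_permM (s : 'S_n) (F : 'S_n -> R) :
  unif_mean (fun p => F (s * p)%g) = unif_mean F.
Proof.
rewrite /unif_mean; congr (_ / _).
by rewrite [RHS](reindex_inj (mulgI s)).
Qed.

Lemma card_perm_gt0 : (0 < #|{: 'S_n}|)%N.
Proof. by apply/card_gt0P; exists 1%g. Qed.

Lemma sum_perm c (p : 'S_n) : \sum_i c (p i) = \sum_i c i.
Proof. by rewrite [RHS](reindex_inj (@perm_inj _ p)). Qed.

Lemma unif_mean_sum (T I : finType) (P : pred I) (F : I -> T -> R) :
  unif_mean (fun u => \sum_(i | P i) F i u) = \sum_(i | P i) unif_mean (F i).
Proof. by rewrite /unif_mean exchange_big mulr_suml. Qed.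

(** Translation by a transposition shows that all positions have the same mean, and the sum over
    positions does not depend on [p]. *)
Lemma unif_mean_perm c (i : 'I_n) :
  n%:R * unif_mean (fun p : 'S_n => c (p i)) = \sum_j c j.
Proof.
have E j : unif_mean (fun p : 'S_n => c (p j)) = unif_mean (fun p : 'S_n => c (p i)).
  rewrite -(unif_mean_permM (tperm i j)); apply: unif_mean_eq => p.
  by rewrite permM tpermR.
have -> : n%:R * unif_mean (fun p : 'S_n => c (p i)) =
    \sum_j unif_mean (fun p : 'S_n => c (p j)).
  by rewrite (eq_bigr _ (fun j _ => E j)) sumr_const card_ord mulr_natl.
rewrite -unif_mean_sum (unif_mean_eq _ _ _ (fun=> \sum_j c j)).
  by rewrite unif_mean_cst // card_perm_gt0.
by move=> p; rewrite sum_perm.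
Qed.

(** Multiply [c (p i)] by the vanishing total over all positions: the [n - 1] off-diagonal means are
    equal and cancel the diagonal one. *)
Lemma unif_mean_perm2 c (i j : 'I_n) : \sum_k c k = 0 -> j != i ->
  (n%:R - 1) * unif_mean (fun p : 'S_n => c (p i) * c (p j)) =
  - unif_mean (fun p : 'S_n => c (p i) ^+ 2).
Proof.
move=> c0 ji.
have E k : k != i -> unif_mean (fun p : 'S_n => c (p i) * c (p k)) =
    unif_mean (fun p : 'S_n => c (p i) * c (p j)).
  move=> ki; rewrite -(unif_mean_permM (tperm j k)); apply: unif_mean_eq => p.
  by rewrite !permM tpermR tpermD.
have : \sum_k unif_mean (fun p : 'S_n => c (p i) * c (p k)) = 0.
  rewrite -unif_mean_sum (unif_mean_eq _ _ _ (fun=> 0)).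
    by rewrite unif_mean_cst // card_perm_gt0.
  by move=> p; rewrite -mulr_sumr sum_perm c0 mulr0.
rewrite (bigD1 i) //= (eq_bigr _ E) sumr_const cardC1 card_ord.
rewrite -[_ *+ _]mulr_natl => H.
have n0 : (0 < n)%N by apply: leq_trans (ltn_ord i).
rewrite -subn1 natrB // in H.
by apply/eqP; rewrite -addr_eq0 addrC; apply/eqP.
Qed.

Lemma unif_mean_perm_sum_sqr c A : \sum_k c k = 0 -> (1 < n)%N ->
  n%:R * (n%:R - 1) * unif_mean (fun p : 'S_n => (\sum_(i in A) c (p i)) ^+ 2) =
  #|A|%:R * (n%:R - #|A|%:R) * \sum_j c j ^+ 2.
Proof.
move=> c0 n1.
set C := \sum_j _.
have M1 i : n%:R * unif_mean (fun p : 'S_n => c (p i) * c (p i)) = C.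
  exact: (unif_mean_perm (fun j => c j ^+ 2)).
have M2 i j : j != i ->
    n%:R * (n%:R - 1) * unif_mean (fun p : 'S_n => c (p i) * c (p j)) = - C.
  move=> ji; rewrite -mulrA unif_mean_perm2 // mulrN; congr (- _).
  exact: (unif_mean_perm (fun j => c j ^+ 2)).
have -> : unif_mean (fun p : 'S_n => (\sum_(i in A) c (p i)) ^+ 2) =
    \sum_(i in A) \sum_(j in A) unif_mean (fun p : 'S_n => c (p i) * c (p j)).
  under [RHS]eq_bigr do rewrite -unif_mean_sum.
  rewrite -unif_mean_sum; apply: unif_mean_eq => p.
  by rewrite expr2 mulr_suml; apply: eq_bigr => i _; rewrite mulr_sumr.
rewrite mulr_sumr.
(* With C the sum of squares, each row contributes (n - 1) C from the diagonal and -C from each of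
   the [#|A|.-1] other entries. *)
under eq_bigr => i iA.
  rewrite mulr_sumr (bigD1 i) //=.
  under [X in _ + X]eq_bigr => j /andP[_ ji] do rewrite M2 //.
  rewrite (mulrAC n%:R) M1 sumr_const.
  rewrite (_ : #|_| = #|A|.-1); last first.
    by rewrite (cardsD1 i A) iA /=; apply: eq_card => j; rewrite !inE andbC.
  over.
rewrite sumr_const.
(* The predecessor truncates at 0, so empty [A] is separate. *)
have [->|A0] := posnP #|A|; first by rewrite mulr0n !mul0r.
by rewrite -subn1 -mulr_natl -[X in _ + X]mulr_natl natrB //; ring.
Qed.

Lemma hamming_lipschitz c A : (forall i j, `|c i - c j| <= 1) ->
  Defs.lipschitz (fun p q : 'S_n => (hamming p q)%:R)
    (fun p => 2 * \sum_(i in A) c (p i)).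
Proof.
move=> c1 p q.
have S0 : \sum_i (c (p i) - c (q i)) = 0 by rewrite sumrB !sum_perm subrr.
rewrite -mulrBr -sumrB.
(* Subtracting the vanishing total [S0] gives every index a sign, so an index where [p] and [q]
   differ costs at most 1 and the others nothing. *)
have -> : 2 * \sum_(i in A) (c (p i) - c (q i)) =
    \sum_i (-1) ^+ (i \notin A) * (c (p i) - c (q i)).
  rewrite [RHS](bigID (mem A)) /=; move: S0; rewrite (bigID (mem A)) /=.
  under [X in _ = X + _]eq_bigr => i -> do rewrite mul1r.
  under [X in _ = _ + X]eq_bigr => i -> do rewrite mulN1r.
  by rewrite sumrN; lra.
apply: le_trans (ler_norm_sum _ _ _) _.
rewrite /hamming -sum1_card natr_sum [leRHS]big_mkcond /=.
apply: ler_sum => i _; rewrite normrM normr_sign mul1r inE.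
by case: eqVneq => [->|_] /=; rewrite ?subrr ?normr0.
Qed.

End Permutations.

Lemma subgaussian_constant_S (R : realType) (n : nat) : (3 <= n)%N ->
  ((n%:R / 4)%:E
     < subgaussian_constant (fun p q : 'S_n => (hamming p q)%:R : R))%E.
Proof.
move=> n3; have n1 : (1 < n)%N by exact: ltnW.
pose k := n./2.
have kn : (k <= n)%N by rewrite -[X in (_ <= X)%N](odd_double_half n) -addnn addnA leq_addl.
pose A : {set 'I_n} := [set i : 'I_n | (i < k)%N].
have cA : #|A| = k.
  rewrite -sum1_card (eq_bigl (fun i : 'I_n => (i < k)%N)); last first.
    by move=> i; rewrite inE.
  by rewrite (big_ord_narrow kn) sum1_card card_ord.
(* The centred indicator of [A]: its total vanishes, as the second-moment formula requires. *)
pose c (j : 'I_n) : R := (j \in A)%:R - k%:R / n%:R.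
have n0 : n%:R != 0 :> R by rewrite pnatr_eq0 -lt0n ltnW.
have sumA : \sum_j (j \in A)%:R = k%:R :> R.
  by rewrite -natr_sum -big_mkcond /= sum1_card cA.
have sumcst (a : R) : \sum_(j < n) a = n%:R * a.
  by rewrite sumr_const card_ord mulr_natl.
have c0 : \sum_j c j = 0 by rewrite sumrB sumA sumcst mulrC divfK ?subrr.
have c2 : \sum_j c j ^+ 2 = k%:R * (n%:R - k%:R) / n%:R.
  have E j : c j ^+ 2 = (1 - 2 * (k%:R / n%:R)) * (j \in A)%:R + (k%:R / n%:R) ^+ 2.
    by rewrite /c; case: (j \in A) => /=; ring.
  by rewrite (eq_bigr _ (fun j _ => E j)) big_split -mulr_sumr sumA sumcst /=; field.
pose X (p : 'S_n) := 2 * \sum_(i in A) c (p i).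
have X0 : unif_mean X = 0.
  rewrite unif_meanZ unif_mean_sum big1 ?mulr0 // => i _.
  by apply: (mulfI n0); rewrite mulr0 unif_mean_perm.
have lipX : Defs.lipschitz (fun p q : 'S_n => (hamming p q)%:R) X.
  apply: hamming_lipschitz => i j; rewrite /c opprB addrA subrK.
  by do 2![case: (_ \in A)] => /=; rewrite ?subrr ?sub0r ?subr0 ?normrN ?normr0 ?normr1.
apply: lt_le_trans (variance_le_subgaussian_constant _ _ _ _ (card_perm_gt0 n) lipX).
rewrite X0 lte_fin.
rewrite (unif_mean_eq _ _ _ (fun p : 'S_n => 4 * (\sum_(i in A) c (p i)) ^+ 2)); last first.
  by move=> p; rewrite subr0 /X; ring.
rewrite unif_meanZ; set V := unif_mean _.
have := unif_mean_perm_sum_sqr R n c A c0 n1; rewrite cA c2 -/V => HV.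
have n1' : 2 < n%:R :> R by rewrite ltr_nat.
have nn1 : 0 < n%:R ^+ 2 * (n%:R - 1) :> R.
  by rewrite mulr_gt0 ?exprn_gt0 //; lra.
have {HV} -> : V = (k%:R * (n%:R - k%:R)) ^+ 2 / (n%:R ^+ 2 * (n%:R - 1)).
  apply: (mulIf (lt0r_neq0 nn1)); rewrite divfK ?lt0r_neq0 //.
  rewrite (_ : V * _ = n%:R * (n%:R * (n%:R - 1) * V)); last by ring.
  by rewrite HV; field.
rewrite mulrA ltr_pdivlMr //.
have k1 : 1 <= k%:R :> R by rewrite ler1n half_gt0.
have -> : n%:R = (odd n)%:R + 2 * k%:R :> R.
  by rewrite -{1}(odd_double_half n) natrD -muln2 natrM mulrC.
move: k1; move: (k%:R : R) => K K1.
have K3 : 0 < K ^+ 3 by rewrite exprn_gt0 //; lra.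
(* For even n the gap is 2 K^3; for odd n it is the product displayed below. *)
case: (odd n) => /=; last by lra.
rewrite -subr_gt0 (_ : _ - _ = K / 2 * (4 * K ^+ 2 + 2 * K - 1)); last by field.
by rewrite mulr_gt0 //; nra.
Qed.

Theorem theorem2p4 (R : realType) (n : nat) (hn : (3 <= n)%N) :
  ((n%:R / 4)%:E
     < subgaussian_constant (fun p q : 'S_n => (hamming p q)%:R : R))%E
  /\
  (subgaussian_constant (fun u v : Jgraph n => (gdist u v)%:R : R) + (1 / 4)%:E
     < (n%:R / 4)%:E)%E.
Proof. by split; [exact: subgaussian_constant_S | exact: subgaussian_constant_J]. Qed.
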